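(* Let $n\ge 1$, let $T\subset\mathbb{R}^n$ be a simplex with vertices $\mathbf{v}_0,\dots,\mathbf{v}_n$, and let $f:T\to\mathbb{R}$ be a convex function. Then $$0\le \mathcal{L}(f,T)\le n\,\mathcal{R}(f,T).$$ The constant $n$ in this inequality cannot be improved: for every real number $c<n$ there is a convex function $f:T\to\mathbb{R}$ for which the inequality $\mathcal{L}(f,T)\le c\,\mathcal{R}(f,T)$ fails.
   Context: The convex hull $T$ of $n+1$ points $\mathbf{v}_0,\dots,\mathbf{v}_n\in\mathbb{R}^n$ is called a simplex, with vertices $\mathbf{v}_0,\dots,\mathbf{v}_n$, if the vectors $\mathbf{v}_1-\mathbf{v}_0,\dots,\mathbf{v}_n-\mathbf{v}_0$ are linearly independent. $|T|$ denotes the volume ($n$-dimensional Lebesgue measure) of $T$. For a convex function $f:T\to\mathbb{R}$ put $$\mathcal{L}(f,T)=\frac{1}{|T|}\int_T f(\mathbf{x})\,d\mathbf{x}-f\left(\frac{1}{n+1}\sum_{i=0}^n\mathbf{v}_i\right),$$ $$\mathcal{R}(f,T)=\frac{1}{n+1}\sum_{i=0}^n f(\mathbf{v}_i)-\frac{1}{|T|}\int_T f(\mathbf{x})\,d\mathbf{x}.$$ *)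

(* Defs.v *)
From HB Require Import structures.
From mathcomp Require Import all_boot all_order all_algebra.
From mathcomp Require Import all_classical all_reals all_analysis.
Set Implicit Arguments.
Unset Strict Implicit.
Unset Printing Implicit Defensive.
Import Order.TTheory GRing.Theory Num.Theory.
Import numFieldNormedType.Exports.
Local Open Scope classical_set_scope.
Local Open Scope ring_scope.

(* The sigma-algebra generated by the coordinate functions, which is the Borel
   sigma-algebra of R^n. *)
Section measurable_rV.
Context {R : realType}.
Variable n : nat.

Let coord (i : 'I_n) (x : 'rV[R]_n) : measurableTypeR R := x ord0 i.

Let rV_set0 : g_sigma_preimage coord set0.
Proof. exact: sigma_algebra0. Qed.

Let rV_setC A : g_sigma_preimage coord A -> g_sigma_preimage coord (~` A).
Proof. exact: sigma_algebraC. Qed.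

Let rV_bigcup (F : (set 'rV[R]_n)^nat) :
  (forall i, g_sigma_preimage coord (F i)) ->
  g_sigma_preimage coord (\bigcup_i F i).
Proof. exact: sigma_algebra_bigcup. Qed.

HB.instance Definition _ := @isMeasurable.Build default_measure_display
  'rV[R]_n (g_sigma_preimage coord) rV_set0 rV_setC rV_bigcup.

End measurable_rV.

Section measurable_coord.
Context {R : realType}.

Lemma measurable_coord n (i : 'I_n) :
  measurable_fun setT (fun x : 'rV[R]_n => x ord0 i : measurableTypeR R).
Proof.
move=> _ Y mY; rewrite setTI; apply: sub_sigma_algebra => /=.
rewrite -bigcup_seq/=; exists i => /=; first by rewrite mem_index_enum.
by exists Y => //; rewrite setTI.
Qed.

Lemma measurable_fun_coordP d (T : measurableType d) n (f : T -> 'rV[R]_n) :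
  (forall i, measurable_fun setT (fun t => f t ord0 i : measurableTypeR R)) ->
  measurable_fun setT f.
Proof.
move=> mf _ A mA; rewrite setTI.
pose F := image_set_system setT f measurable.
suff : measurable `<=` F by move=> /(_ _ mA); rewrite /F/image_set_system/= setTI.
apply: smallest_sub.
  by apply: sigma_algebra_image; exact: sigma_algebra_measurable.
move=> B; rewrite -bigcup_seq/= => -[i _ [C mC <-]].
by rewrite /F /image_set_system/= !setTI; have := mf i measurableT _ mC; rewrite setTI.
Qed.

Definition rV_cons n (p : measurableTypeR R * 'rV[R]_n) : 'rV[R]_n.+1 :=
  row_mx (const_mx p.1 : 'rV_1) p.2.

Definition rV_uncons n (x : 'rV[R]_n.+1) : measurableTypeR R * 'rV[R]_n :=
  (x ord0 ord0, rsubmx (x : 'rV_(1 + n))).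

Lemma rV_cons0 n (p : measurableTypeR R * 'rV[R]_n) :
  rV_cons p ord0 ord0 = p.1.
Proof.
have /= <- := congr1 (fun i => rV_cons p ord0 i)
  (val_inj (erefl : val (lshift n (ord0 : 'I_1)) = val (ord0 : 'I_n.+1))).
by rewrite [LHS]row_mxEl mxE.
Qed.

Lemma rV_consS n (p : measurableTypeR R * 'rV[R]_n) i :
  rV_cons p ord0 (lift ord0 i) = p.2 ord0 i.
Proof.
have <- : rshift 1 i = lift ord0 i by exact/val_inj.
by rewrite [LHS]row_mxEr.
Qed.

Lemma rV_consK n : cancel (@rV_cons n) (@rV_uncons n).
Proof.
by move=> p; rewrite /rV_uncons rV_cons0 row_mxKr -surjective_pairing.
Qed.

Lemma measurable_rV_cons n : measurable_fun setT (@rV_cons n).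
Proof.
apply: measurable_fun_coordP => i; have [j ->|->] := unliftP ord0 i.
  under eq_fun do rewrite rV_consS.
  exact: (measurableT_comp (measurable_coord j) measurable_snd).
by under eq_fun do rewrite rV_cons0; exact: measurable_fst.
Qed.

Lemma measurable_rV_uncons n : measurable_fun setT (@rV_uncons n).
Proof.
apply: measurable_fun_pair; first exact: measurable_coord.
apply: measurable_fun_coordP => i.
by under eq_fun do rewrite mxE; exact: measurable_coord.
Qed.

End measurable_coord.

Section lebesgue_rV.
Local Open Scope ereal_scope.
Context {R : realType}.

Section step.
Variables (n : nat) (mu : {sigma_finite_measure set 'rV[R]_n -> \bar R}).

Definition lebesgue_rV_step : set 'rV[R]_n.+1 -> \bar R :=
  pushforward (lebesgue_measure \x mu) (@rV_cons R n).

Let step0 : lebesgue_rV_step set0 = 0.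
Proof. by rewrite /lebesgue_rV_step /pushforward preimage_set0 measure0. Qed.

Let step_ge0 A : 0 <= lebesgue_rV_step A.
Proof. by rewrite /lebesgue_rV_step /pushforward; exact: measure_ge0. Qed.

Let step_sigma_additive : semi_sigma_additive lebesgue_rV_step.
Proof.
have mcons := @measurable_rV_cons R n; rewrite /lebesgue_rV_step.
exact: measure_semi_sigma_additive.
Qed.

HB.instance Definition _ := isMeasure.Build _ _ _ lebesgue_rV_step
  step0 step_ge0 step_sigma_additive.

Let step_sigma_finite : sigma_finite setT lebesgue_rV_step.
Proof.
have /sigma_finiteP[F [TF ndF Foo]] := sigma_finiteT (@lebesgue_measure R).
have /sigma_finiteP[G [TG ndG Goo]] := sigma_finiteT mu.
exists (fun k => @rV_uncons R n @^-1` (F k `*` G k)).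
  apply/esym; rewrite -preimage_bigcup -subTset => x _ /=.
  have [k _ Fk] : (\bigcup_k F k) (rV_uncons x).1 by rewrite -TF.
  have [l _ Gl] : (\bigcup_k G k) (rV_uncons x).2 by rewrite -TG.
  exists (maxn k l) => //; split.
    by move: Fk; exact/subsetPset/ndF/leq_maxl.
  by move: Gl; exact/subsetPset/ndG/leq_maxr.
move=> k; have [mF Fk] := Foo k; have [mG Gk] := Goo k.
have mFG : measurable (F k `*` G k) by exact: measurableX.
split; first by rewrite -[X in measurable X]setTI; exact: measurable_rV_uncons.
rewrite /lebesgue_rV_step /pushforward -comp_preimage.
rewrite (_ : _ \o _ = id); last by apply/funext => p; exact: rV_consK.
by rewrite preimage_id product_measure1E// lte_mul_pinfty// ge0_fin_numE.
Qed.

HB.instance Definition _ := Measure_isSigmaFinite.Build _ _ _ lebesgue_rV_step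
  step_sigma_finite.

End step.

(* n-dimensional Lebesgue measure on Borel sets, as an iterated product
   measure; [lebesgue_rV_box] gives its characteristic value on boxes. *)
Fixpoint lebesgue_rV (n : nat) : {sigma_finite_measure set 'rV[R]_n -> \bar R} :=
  match n with
  | 0 => \d_(0%R : 'rV[R]_0)
  | m.+1 => lebesgue_rV_step (lebesgue_rV m)
  end.

Lemma lebesgue_rV_box n (A : 'I_n -> set (measurableTypeR R)) :
  (forall i, measurable (A i)) ->
  lebesgue_rV n [set x | forall i, A i (x ord0 i)] =
  \prod_(i < n) lebesgue_measure (A i).
Proof.
elim: n A => [|n IHn] A mA.
  by rewrite big_ord0 /= diracE mem_set// => -[].
have mB : measurable [set x : 'rV[R]_n | forall i, A (lift ord0 i) (x ord0 i)].
  rewrite (_ : [set x | _] = \bigcap_(i in [set: 'I_n])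
      ((fun x : 'rV[R]_n => x ord0 i : measurableTypeR R) @^-1` A (lift ord0 i))).
    apply: fin_bigcap_measurable => // i _.
    by rewrite -[X in measurable X]setTI; exact: measurable_coord.
  by apply/seteqP; split => [x xA i _|x xA i]; exact: xA.
rewrite big_ord_recl -IHn//= /lebesgue_rV_step /pushforward.
rewrite -product_measure1E//.
congr ((_ \x _) _); apply/seteqP; split => -[a x] /=.
  move=> axA; split; first by have := axA ord0; rewrite rV_cons0.
  by move=> i; have := axA (lift ord0 i); rewrite rV_consS.
move=> [aA xA] i; have [j ->|->] := unliftP ord0 i.
  by rewrite rV_consS; exact: xA.
by rewrite rV_cons0.
Qed.

End lebesgue_rV.

Definition convex_hull (R : realType) (V : lmodType R) (A : set V) : set V :=
  smallest (@convex_set R V) A.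

Section simplex.
Context {R : realType} {n : nat}.
Implicit Types (v : 'I_n.+1 -> 'rV[R]_n) (f : 'rV[R]_n -> R).

Definition simplex_vertices v : Prop :=
  free [seq v (lift ord0 i) - v ord0 | i : 'I_n].

Definition simplex v : set 'rV[R]_n := convex_hull (range v).

(* The mean value (1/|T|) int_T f of f over the simplex T with vertices v. Only
   the values of f on T matter, here and in the gaps below. *)
Definition simplex_mean v f : R :=
  (fine (lebesgue_rV n (simplex v)))^-1 *
  (\int[lebesgue_rV n]_(x in simplex v) f x)%R.

(* L(f, T) *)
Definition left_gap v f : R :=
  simplex_mean v f - f (n.+1%:R^-1 *: \sum_i v i).

(* R(f, T) *)
Definition right_gap v f : R :=
  n.+1%:R^-1 * (\sum_i f (v i)) - simplex_mean v f.

End simplex.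

(* Main.v *)
Require Import Defs.
From mathcomp Require Import all_boot all_order all_algebra.
From mathcomp Require Import all_classical all_reals all_analysis.
From mathcomp Require Import measurable_realfun.
From mathcomp Require Import ring lra.
Set Implicit Arguments.
Unset Strict Implicit.
Unset Printing Implicit Defensive.
Import Order.TTheory GRing.Theory Num.Theory.
Import numFieldNormedType.Exports.
Local Open Scope classical_set_scope.
Local Open Scope ring_scope.

(** Everything rests on the affine symmetries of the simplex. In barycentric
    coordinates, the cyclic permutations of the vertices are affine
    automorphisms of [T], and they preserve mean values over [T]. So [f] has
    the same mean as its average [g] over these automorphisms. At every point,
    Jensen's inequality gives [f(b) <= g <= avg_i f(v_i)], where [b] is the
    centroid, because the orbit of a point has average [b]. Taking means
    yields the two Hermite-Hadamard inequalities [centroid_le_mean] and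
    [mean_le_vertices]; the first one is [0 <= L].

    For [L <= n R], cut [T] into the [n + 1] cones [T_i] with apex [b] over
    the facets. They have equal volumes, since the symmetries permute them,
    and they overlap in null sets, so the mean over [T] is the average of the
    means over the [T_i] ([mean_cone]). The bound [mean_le_vertices] on each
    [T_i], whose vertices are [b] and all the [v_k] with [k != i], gives by
    averaging [(n + 1) mean <= f(b) + n avg_k f(v_k)], which is [L <= n R].

    Equality holds for a convex function that is affine on every cone, such as
    [- min_i (barycentric coordinate i)], for which [R = 1 / (n + 1)^2] and [L
    = n / (n + 1)^2]. As [R > 0], no [c < n] can replace [n].

    Two analytic facts support this. Mean values are invariant under affine
    maps between simplices ([mean_affmap]); this follows from the translation
    invariance of Lebesgue measure by the uniqueness argument for Haar measure
    ([lebesgue_rV_preimage_mul]), without any determinant. And a convex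
    function on a simplex is bounded and upper semicontinuous, hence
    integrable ([convex_function_integrable]), whatever it does on the
    boundary. *)

(** * Barycentric coordinates *)

Section barycentric.
Context {R : realType} {n : nat}.
Implicit Types (v w : 'I_n.+1 -> 'rV[R]_n) (x y : 'rV[R]_n).

(** The symmetric form of affine independence: unlike the differences [v_i -
    v_0], it singles out no vertex, so it passes at once to reordered vertices
    and to the cones over the facets. *)
Definition aff_indep v : Prop :=
  forall u : 'I_n.+1 -> R,
    \sum_i u i = 0 -> \sum_i u i *: v i = 0 -> forall i, u i = 0.

Lemma simplex_vertices_aff_indep v : simplex_vertices v -> aff_indep v.
Proof.
move=> fv u u0 uv0.
have uS j : u (lift ord0 j) = 0.
  pose X := [tuple v (lift ord0 i) - v ord0 | i < n].
  have fX : free X by rewrite /X /=.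
  have /freeP/(_ (fun k => u (lift ord0 k))) -> // := fX.
  rewrite -[RHS]uv0 big_ord_recl.
  rewrite (eq_bigr (fun i => u (lift ord0 i) *: v (lift ord0 i)
     - u (lift ord0 i) *: v ord0)); last first.
    by move=> i _; rewrite (nth_map i) ?size_enum_ord// nth_ord_enum scalerBr.
  rewrite sumrB -scaler_suml addrC -scaleNr; congr (_ *: _ + _).
  by apply/eqP; rewrite eq_sym -addr_eq0 -[X in X == _]big_ord_recl u0.
move=> i; case: (unliftP ord0 i) => [j ->|->]; first exact: uS.
by move: u0; rewrite big_ord_recl big1 ?addr0// => j _; exact: uS.
Qed.

(** In homogeneous coordinates [x] becomes the row [(1, x)], affine
    independence of [v] becomes invertibility of the matrix with rows [(1,
    v_k)], and the barycentric coordinates of [x] are the solution of a linear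
    system. *)
Let hom x : 'rV[R]_n.+1 := rV_cons (1 : R, x).

Let hom_sum (I : finType) (l : I -> R) (x : I -> 'rV[R]_n) :
  \sum_k l k *: hom (x k) = rV_cons (\sum_k l k, \sum_k l k *: x k).
Proof.
apply/rowP => i; rewrite summxE.
case: (unliftP ord0 i) => [j ->|->].
  rewrite rV_consS /= summxE; apply: eq_bigr => k _.
  by rewrite mxE [in RHS]mxE rV_consS.
rewrite rV_cons0 /=; apply: eq_bigr => k _.
by rewrite mxE /hom rV_cons0 mulr1.
Qed.

Definition bary v i x : R :=
  (hom x *m invmx (\matrix_k hom (v k))) ord0 i.

Let hom_mx_unit v : aff_indep v -> \matrix_k hom (v k) \in unitmx.
Proof.
move=> vi; rewrite -row_free_unit -kermx_eq0; apply/eqP/row_matrixP => r.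
have := mulmx_ker (\matrix_k hom (v k)); move/(congr1 (row r)).
rewrite row_mul row0 mulmx_sum_row; set u := row r _.
under eq_bigr do rewrite rowK.
rewrite hom_sum => u0; apply/rowP => i; rewrite [RHS]mxE.
apply: (vi (u ord0)).
  by have /rowP/(_ ord0) := u0; rewrite rV_cons0 mxE.
apply/rowP => j; have /rowP/(_ (lift ord0 j)) := u0.
by rewrite rV_consS mxE => ->; rewrite mxE.
Qed.

Let baryP v x : aff_indep v ->
  rV_cons (\sum_i bary v i x, \sum_i bary v i x *: v i) = hom x.
Proof.
move=> vi; rewrite -hom_sum.
rewrite -[RHS](mulmxKV (hom_mx_unit vi)) mulmx_sum_row.
by apply: eq_bigr => i _; rewrite rowK.
Qed.

Lemma sum_bary v x : aff_indep v -> \sum_i bary v i x = 1.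
Proof.
by move=> /baryP - /(_ x)/rowP/(_ ord0); rewrite /hom !rV_cons0.
Qed.

Lemma baryK v x : aff_indep v -> \sum_i bary v i x *: v i = x.
Proof.
move=> /baryP - /(_ x)/rowP H; apply/rowP => j.
by have := H (lift ord0 j); rewrite /hom !rV_consS.
Qed.

Lemma bary_sum v (I : finType) (l : I -> R) (x : I -> 'rV[R]_n) i :
  \sum_k l k = 1 -> bary v i (\sum_k l k *: x k) = \sum_k l k * bary v i (x k).
Proof.
move=> l1; rewrite /bary {1}/hom -l1 -hom_sum mulmx_suml summxE.
by apply: eq_bigr => k _; rewrite -scalemxAl mxE.
Qed.

Lemma bary_conv v i t x y :
  bary v i (t *: x + (1 - t) *: y) = t * bary v i x + (1 - t) * bary v i y.
Proof.
pose l (b : bool) := if b then t else 1 - t.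
pose xy (b : bool) := if b then x else y.
have := @bary_sum v bool l xy i; rewrite !big_bool /=; apply.
by rewrite addrC subrK.
Qed.

Lemma bary_vertex v i j : aff_indep v -> bary v i (v j) = (i == j)%:R.
Proof.
move=> vi.
suff -> : bary v i (v j) = (1%:M : 'M[R]_n.+1) j i by rewrite mxE eq_sym.
rewrite -(mulmxV (hom_mx_unit vi)) /bary.
have -> : hom (v j) = row j (\matrix_k hom (v k)) by rewrite rowK.
by rewrite -row_mul [LHS]mxE.
Qed.

Lemma bary_comb v l i : aff_indep v -> \sum_k l k = 1 ->
  bary v i (\sum_k l k *: v k) = l i.
Proof.
move=> vi l1; rewrite bary_sum// (bigD1 i)//= big1 ?addr0.
  by rewrite bary_vertex// eqxx mulr1.
by move=> k ki; rewrite bary_vertex// eq_sym (negbTE ki) mulr0.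
Qed.

(** Used whenever only the affine dependence on [x] matters (measurability,
    translations, estimates near the centroid). *)
Lemma baryE v i : exists a (d : 'I_n -> R), forall x,
  bary v i x = a + \sum_j x ord0 j * d j.
Proof.
set M := invmx (\matrix_k hom (v k)).
exists (M ord0 i), (fun j => M (lift ord0 j) i) => x.
rewrite /bary mxE /hom big_ord_recl rV_cons0 mul1r; congr (_ + _).
by apply: eq_bigr => j _; rewrite rV_consS.
Qed.

Lemma baryD v i x y : bary v i (x + y) = bary v i x + (bary v i y - bary v i 0).
Proof.
have [a [d H]] := baryE v i; rewrite !H [X in _ - (a + X)]big1 => [|j _].
  rewrite (_ : _ + (_ - _) = a + (\sum_j x ord0 j * d j + \sum_j y ord0 j * d j)).
    by rewrite -big_split; congr (_ + _); apply: eq_bigr => j _; rewrite mxE mulrDl.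
  by ring.
by rewrite mxE mul0r.
Qed.

Lemma measurable_bary v i :
  measurable_fun setT (bary v i : 'rV[R]_n -> measurableTypeR R).
Proof.
have [a [d H]] := baryE v i; 
rewrite (_ : bary v i = fun x => a + \sum_j x ord0 j * d j); last exact/funext.
apply: measurable_funD; first exact: measurable_cst.
by apply: measurable_sum => j; apply: measurable_funM => //; exact: measurable_coord.
Qed.

End barycentric.

(** * Convex combinations and the simplex *)

Section convexity.
Context {R : realType}.

Lemma convex_setP (V : lmodType R) (A : set V) : convex_set A <->
  forall (t : R) x y, 0 <= t -> t <= 1 -> A x -> A y ->
    A (t *: x + (1 - t) *: y).
Proof.
split=> [cA t x y t0 t1 Ax Ay|cA x y t /set_mem Ax /set_mem Ay].
  by have := cA x y (Itv01 t0 t1) (mem_set Ax) (mem_set Ay) => /set_mem.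
by apply/mem_set; exact: cA.
Qed.

Lemma convex_functionP (V : lmodType R) (D : set V) (f : V -> R) :
  convex_function D f <->
  forall (t : R) x y, 0 <= t -> t <= 1 -> D x -> D y ->
    f (t *: x + (1 - t) *: y) <= t * f x + (1 - t) * f y.
Proof.
split=> [cf t x y t0 t1 Dx Dy|cf t x y /set_mem Dx /set_mem Dy].
  exact: (cf (Itv01 t0 t1) x y (mem_set Dx) (mem_set Dy)).
exact: cf.
Qed.

(** The partial sums have total weight below 1, so the induction on the index
    sequence runs on the normalized combinations. *)
Lemma convex_set_sum (V : lmodType R) (A : set V) (I : finType) (l : I -> R)
    (x : I -> V) :
  convex_set A -> (forall i, 0 <= l i) -> \sum_i l i = 1 ->
  (forall i, A (x i)) -> A (\sum_i l i *: x i).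
Proof.
move=> /convex_setP cA l0 l1 Ax.
suff H (s : seq I) : 0 < \sum_(i <- s) l i ->
    A ((\sum_(i <- s) l i)^-1 *: \sum_(i <- s) l i *: x i).
  by have := H (index_enum I); rewrite l1 invr1 scale1r; apply.
elim: s => [|i s IHs]; first by rewrite big_nil ltxx.
rewrite !big_cons; set L := \sum_(_ <- _) _; set S := \sum_(_ <- _) _.
have L_ge0 : 0 <= L by exact: sumr_ge0.
move=> iL; have [L0|L_gt0] := eqVneq L 0.
  have -> : S = 0.
    rewrite /S big_seq big1// => j js; move/eqP: L0.
    rewrite /L psumr_eq0// => /allP/(_ j js)/eqP ->.
    by rewrite scale0r.
  rewrite L0 !addr0 scalerA mulVf ?scale1r//.
  by move: iL; rewrite L0 addr0 => /gt_eqF ->.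
have := cA (l i / (l i + L)) (x i) (L^-1 *: S).
rewrite (_ : 1 - _ = L / (l i + L)); last by field; rewrite gt_eqF.
rewrite scalerA mulrAC divff// mul1r scalerDr scalerA [_^-1 * _]mulrC; apply => //.
- by rewrite divr_ge0// ltW.
- by rewrite ler_pdivrMr// mul1r lerDl.
- by apply: IHs; rewrite lt_neqAle eq_sym L_gt0.
Qed.

(** Jensen's inequality follows from the previous lemma applied to the
    epigraph of [f], which is a convex set of [V * R]. *)
Lemma convex_function_sum (V : lmodType R) (D : set V) (f : V -> R)
    (I : finType) (l : I -> R) (x : I -> V) :
  convex_set D -> convex_function D f ->
  (forall i, 0 <= l i) -> \sum_i l i = 1 -> (forall i, D (x i)) ->
  f (\sum_i l i *: x i) <= \sum_i l i * f (x i).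
Proof.
move=> /convex_setP cD /convex_functionP cf l0 l1 Dx.
pose E := [set p : V * R^o | D p.1 /\ f p.1 <= p.2].
have cE : convex_set E.
  apply/convex_setP => t p q t0 t1 [Dp fp] [Dq fq]; split; first exact: cD.
  rewrite (le_trans (cf _ _ _ t0 t1 Dp Dq))//=.
  by apply: lerD; apply: ler_wpM2l => //; rewrite subr_ge0.
have := @convex_set_sum _ E I l (fun i => (x i, f (x i))) cE l0 l1.
move=> /(_ (fun i => conj (Dx i) (lexx _))) [_ /=].
by rewrite (raddf_sum fst) (raddf_sum snd).
Qed.

End convexity.

Section simplex.
Context {R : realType} {n : nat}.
Implicit Types (v w : 'I_n.+1 -> 'rV[R]_n) (x y : 'rV[R]_n).

(** The half-spaces on the right form a convex set that contains the vertices;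
    conversely the barycentric coordinates exhibit [x] as a convex combination
    of the vertices. *)
Lemma simplexE v : aff_indep v -> simplex v = [set x | forall i, 0 <= bary v i x].
Proof.
move=> vi; apply/seteqP; split => [x|x x0 C [cC vC]]; last first.
  rewrite -(baryK x vi); apply: convex_set_sum => //.
    exact: sum_bary.
  by move=> i; apply: vC; exists i.
apply; split; last by move=> _ [j _ <-] i; rewrite bary_vertex// ler0n.
apply/convex_setP => t y z t0 t1 y0 z0 i.
by rewrite bary_conv addr_ge0// mulr_ge0// subr_ge0.
Qed.

Lemma simplex_comb v l : (forall i, 0 <= l i) -> \sum_i l i = 1 ->
  simplex v (\sum_i l i *: v i).
Proof.
by move=> l0 l1 C [cC vC]; apply: convex_set_sum => // i; apply: vC; exists i.
Qed.

Lemma simplex_vertex v i : simplex v (v i).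
Proof. by move=> C [_]; apply; exists i. Qed.

Lemma convex_simplex v : convex_set (simplex v).
Proof.
apply/convex_setP => t x y t0 t1 xv yv C CvC.
by move/convex_setP: (CvC.1); apply => //; [exact: xv|exact: yv].
Qed.

Lemma bary_ge0 v i x : aff_indep v -> simplex v x -> 0 <= bary v i x.
Proof. by move=> vi; rewrite simplexE. Qed.

Lemma bary_le1 v i x : aff_indep v -> simplex v x -> bary v i x <= 1.
Proof.
move=> vi vx; rewrite -(sum_bary x vi) (bigD1 i)//= lerDl sumr_ge0// => j _.
exact: bary_ge0.
Qed.

Lemma sub_simplex v w : (forall i, simplex v (w i)) -> simplex w `<=` simplex v.
Proof.
move=> wv; apply: smallest_sub; first exact: convex_simplex.
by move=> _ [i _ <-].
Qed.

Lemma convex_function_bary v f x : aff_indep v ->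
  convex_function (simplex v) f -> simplex v x ->
  f x <= \sum_i bary v i x * f (v i).
Proof.
move=> vi cf vx; rewrite -[in leLHS](baryK x vi).
apply: (@convex_function_sum _ _ (simplex v) f _ (bary v ^~ x) v) => // [|i||i].
- exact: convex_simplex.
- exact: bary_ge0.
- exact: sum_bary.
- exact: simplex_vertex.
Qed.

Lemma convex_functionS v w f : simplex w `<=` simplex v ->
  convex_function (simplex v) f -> convex_function (simplex w) f.
Proof.
move=> wv /convex_functionP cf; apply/convex_functionP => t x y t0 t1 xw yw.
by apply: cf => //; exact: wv.
Qed.

Lemma measurable_simplex v : aff_indep v -> measurable (simplex v).
Proof.
move=> vi; rewrite simplexE// (_ : [set x | _] =
    \bigcap_(i in [set: 'I_n.+1]) (bary v i @^-1` `[0, +oo[)).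
  apply: fin_bigcap_measurable => // i _.
  by rewrite -[X in measurable X]setTI; apply: measurable_bary.
apply/seteqP; split => x /= H i => [_|]; first by rewrite /= in_itv/= andbT.
by have := H i I; rewrite /= in_itv/= andbT.
Qed.

End simplex.

(** * Translation invariance of Lebesgue measure, and its uniqueness *)

Section lebesgue_rV_translation.
Local Open Scope ereal_scope.
Context {R : realType}.

Lemma lebesgue_measure_shift (t : R) (A : set (measurableTypeR R)) :
  measurable A ->
  lebesgue_measure ((fun x : R => (x + t)%R) @^-1` A) = lebesgue_measure A.
Proof.
have mt : measurable_fun setT
    ((fun x => (x + t)%R) : measurableTypeR R -> measurableTypeR R).
  exact: measurable_funD.
move=> mA; apply/esym.
apply: (@lebesgue_measure_unique R (pushforward lebesgue_measure
   ((fun x => (x + t)%R) : measurableTypeR R -> measurableTypeR R))) => //=.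
move=> _ [[a b]] _ <-; rewrite /pushforward.
rewrite (_ : _ @^-1` _ = [set` `]a - t, b - t]%R]); last first.
  apply/seteqP; split => x /=; rewrite !in_itv/= => /andP[? ?].
    by apply/andP; split; [rewrite ltrBlDr|rewrite lerBrDr].
  by apply/andP; split; [rewrite -ltrBlDr|rewrite -lerBrDr].
rewrite !lebesgue_measure_itv/= !lte_fin ltrD2r; case: ifPn => // _.
by rewrite -!EFinD; congr EFin; ring.
Qed.

Lemma measurable_addr n (t : 'rV[R]_n) :
  measurable_fun setT (fun x : 'rV[R]_n => (x + t)%R).
Proof.
apply: measurable_fun_coordP => i; under eq_fun do rewrite mxE.
by apply: measurable_funD => //; exact: measurable_coord.
Qed.

Lemma rV_consD n (p : measurableTypeR R * 'rV[R]_n) (t : 'rV[R]_n.+1) :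
  rV_cons ((p.1 + t ord0 ord0)%R : measurableTypeR R,
           (p.2 + rsubmx (t : 'rV_(1 + n)))%R) =
  (rV_cons p + t)%R.
Proof.
apply/rowP => i; rewrite [RHS]mxE; case: (unliftP ord0 i) => [j ->|->].
  by rewrite !rV_consS/= !mxE; congr (_ + t _ _)%R; exact/val_inj.
by rewrite !rV_cons0.
Qed.

(** By induction on the dimension: the translate of the product measure takes
    the same values on rectangles as the product measure, hence equals it. *)
Lemma lebesgue_rV_shift n (t : 'rV[R]_n) (A : set 'rV[R]_n) : measurable A ->
  lebesgue_rV n ((fun x => x + t)%R @^-1` A) = lebesgue_rV n A.
Proof.
elim: n t A => [|n IHn] t A mA.
  rewrite (_ : _ @^-1` A = A)//; apply/funext => x /=.
  by rewrite (thinmx0 t) addr0.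
pose s : R := t ord0 ord0.
pose T : measurableTypeR R * 'rV[R]_n -> measurableTypeR R * 'rV[R]_n :=
  fun p => ((p.1 + s)%R, (p.2 + rsubmx (t : 'rV_(1 + n)))%R).
have mT : measurable_fun setT T.
  apply: measurable_fun_pair.
    by apply: measurable_funD.
  exact: (measurableT_comp (measurable_addr _) measurable_snd).
have mcA : measurable (@rV_cons R n @^-1` A).
  by rewrite -[X in measurable X]setTI; exact: measurable_rV_cons.
pose m' := pushforward (@lebesgue_measure R \x lebesgue_rV n) T.
rewrite /= /lebesgue_rV_step /pushforward.
rewrite [RHS](@product_measure_unique _ _ _ _ _ _ _ m')//.
  rewrite /m' /pushforward; congr (_ _); apply/seteqP.
  by split=> p /=; rewrite rV_consD.
move=> B C mB mC; rewrite /m'/= /pushforward.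
rewrite (_ : _ @^-1` _ = ((fun x => (x + s)%R) @^-1` B) `*`
  ((fun x => (x + rsubmx (t : 'rV_(1 + n)))%R) @^-1` C))//.
rewrite product_measure1E ?IHn ?lebesgue_measure_shift//.
- by congr (_ * _); exact: lebesgue_measure_shift.
- by rewrite -[X in measurable X]setTI; apply: (@measurable_funD _ _ R setT id (cst s)).
- by rewrite -[X in measurable X]setTI; exact: measurable_addr.
Qed.

End lebesgue_rV_translation.

Section affine_change_of_variables.
Local Open Scope ereal_scope.
Context {R : realType} {n : nat}.
Local Notation mu := (@lebesgue_rV R n).

Lemma integral_xsection_ysection d1 d2 (T1 : measurableType d1)
    (T2 : measurableType d2) (m1 : {sigma_finite_measure set T1 -> \bar R})
    (m2 : {sigma_finite_measure set T2 -> \bar R}) (A : set (T1 * T2)) :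
  measurable A -> \int[m1]_x m2 (xsection A x) = \int[m2]_y m1 (ysection A y).
Proof.
move=> mA; have := indic_fubini_tonelli m1 m2 mA.
by rewrite indic_fubini_tonelli_FE// indic_fubini_tonelli_GE.
Qed.

Lemma integral_ysection_cst d1 d2 (T1 : measurableType d1)
    (T2 : measurableType d2) (m1 : {measure set T1 -> \bar R})
    (m2 : {measure set T2 -> \bar R}) (A : set (T1 * T2)) (D : set T2) c :
  measurable D -> 0 <= c -> (forall y, D y -> m1 (ysection A y) = c) ->
  (forall x y, A (x, y) -> D y) ->
  \int[m2]_y m1 (ysection A y) = c * m2 D.
Proof.
move=> mD c0 Ac AD; rewrite (eq_integral (fun y => c * (\1_D y)%:E)).
  rewrite ge0_integralZl// ?integral_indic ?setIT//.
  by apply/measurable_EFinP; exact: measurable_indic.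
move=> y _; rewrite indicE; case: (boolP (y \in D)) => [/set_mem Dy|/negP yD].
  by rewrite mule1 Ac.
rewrite mule0 (_ : ysection A y = set0) ?measure0//.
apply/seteqP; split => // x; rewrite /ysection/= => /set_mem/AD Dy.
by apply: yD; exact/mem_set.
Qed.

Variable phi : 'rV[R]_n -> 'rV[R]_n.
Hypothesis mphi : measurable_fun setT phi.
(** The property of affine bijections that matters here: every translation of
    the target is induced by a translation of the source. *)
Hypothesis phi_shift :
  forall t, exists s, forall y, (phi y + t = phi (y + s))%R.

(** The uniqueness of Haar measure, in the form needed for [phi] affine: the
    map [E |-> mu (phi @^-1` E)] is proportional to [mu]. Both sides compute
    the [mu \x mu]-measure of the pairs [(x, y)] with [x + phi y] in [E] and
    [phi y] in [B]. Integrating over [x] first gives the left-hand side.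
    Integrating over [y] first, the translation of [y] that turns [x + phi y]
    into [phi y] changes the conditions to [phi y] in [E] and [phi y - x] in
    [B]; integrating this new set over [x] first gives the right-hand side. *)
Lemma lebesgue_rV_preimage_mul (E B : set 'rV[R]_n) : measurable E -> measurable B ->
  mu E * mu (phi @^-1` B) = mu (-%R @^-1` B) * mu (phi @^-1` E).
Proof.
move=> mE mB.
have mpre (C : set 'rV[R]_n) : measurable C -> measurable (phi @^-1` C).
  by move=> mC; rewrite -[X in measurable X]setTI; exact: mphi.
have mopp : measurable (-%R @^-1` B : set 'rV[R]_n).
  rewrite -[X in measurable X]setTI; apply: (_ : measurable_fun setT _) => //.
  apply: measurable_fun_coordP => i; under eq_fun do rewrite mxE.
  by apply: measurableT_comp => //; exact: measurable_coord.
(* The set of pairs before ([A1]) and after ([A2]) the translation of [y]. *)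
pose A1 := [set p : 'rV[R]_n * 'rV[R]_n | E (p.1 + phi p.2)%R /\ B (phi p.2)].
pose A2 := [set p : 'rV[R]_n * 'rV[R]_n | E (phi p.2) /\ B (phi p.2 - p.1)%R].
have mphi2 : measurable_fun setT (fun p : 'rV[R]_n * 'rV[R]_n => phi p.2).
  exact: (measurableT_comp mphi).
have mA1 : measurable A1.
  apply: measurableI; last by rewrite -[X in measurable X]setTI; exact: mphi2.
  rewrite -[X in measurable X]setTI.
  apply: (_ : measurable_fun setT
    (fun p : 'rV[R]_n * 'rV[R]_n => p.1 + phi p.2)%R) => //.
  apply: measurable_fun_coordP => i; under eq_fun do rewrite mxE.
  by apply: measurable_funD;
    apply: (measurableT_comp (measurable_coord i)) => //.
have mA2 : measurable A2.
  apply: measurableI; first by rewrite -[X in measurable X]setTI; exact: mphi2.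
  rewrite -[X in measurable X]setTI.
  apply: (_ : measurable_fun setT
    (fun p : 'rV[R]_n * 'rV[R]_n => phi p.2 - p.1)%R) => //.
  apply: measurable_fun_coordP => i; under eq_fun do rewrite !mxE.
  by apply: measurable_funB;
    apply: (measurableT_comp (measurable_coord i)) => //.
rewrite -(@integral_ysection_cst _ _ _ _ mu mu A1)//; first last.
- by move=> x y [].
- move=> y By; rewrite -(lebesgue_rV_shift (phi y) mE); congr (mu _).
  apply/seteqP; split => x; rewrite /ysection/=; first by move/set_mem => -[].
  by move=> Exy; apply/mem_set.
- exact: mpre.
rewrite -(@integral_ysection_cst _ _ _ _ mu mu A2)//; first last.
- by move=> x y [].
- move=> y Ey; rewrite -(lebesgue_rV_shift (- phi y) mopp); congr (mu _).
  apply/seteqP; split => x; rewrite /ysection/= opprD opprK addrC.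
    by move/set_mem => -[].
  by move=> Bxy; apply/mem_set.
- exact: mpre.
rewrite -!integral_xsection_ysection//; apply: eq_integral => x _.
have [s phis] := phi_shift x.
rewrite -(lebesgue_rV_shift s (measurable_xsection x mA2)); congr (mu _).
apply/seteqP; split => y; rewrite /preimage /xsection /= !in_setE /A1 /A2 /=.
  by rewrite -!phis addrK (addrC x).
by rewrite -!phis addrK (addrC x).
Qed.

End affine_change_of_variables.

(** * Volumes and integrals under affine maps *)

Section simplex_volume.
Context {R : realType} {n : nat}.
Implicit Types (v w : 'I_n.+1 -> 'rV[R]_n) (x y : 'rV[R]_n).
Local Notation mu := (@lebesgue_rV R n).

Definition centroid v : 'rV[R]_n := n.+1%:R^-1 *: \sum_i v i.

Lemma sum_inv_card : \sum_(i < n.+1) n.+1%:R^-1 = 1 :> R.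
Proof. by rewrite sumr_const card_ord -[LHS]mulr_natr mulVf// pnatr_eq0. Qed.

Lemma bary_centroid v i : aff_indep v -> bary v i (centroid v) = n.+1%:R^-1.
Proof.
by move=> vi; rewrite /centroid scaler_sumr bary_comb// sum_inv_card.
Qed.

Lemma measurable_box (A : 'I_n -> set (measurableTypeR R)) :
  (forall j, measurable (A j)) ->
  measurable [set x : 'rV[R]_n | forall j, A j (x ord0 j)].
Proof.
move=> mA; rewrite (_ : [set x : 'rV[R]_n | _] = \bigcap_(j in [set: 'I_n])
    ((fun x : 'rV[R]_n => x ord0 j : measurableTypeR R) @^-1` A j)).
  apply: fin_bigcap_measurable => // j _.
  by rewrite -[X in measurable X]setTI; exact: measurable_coord.
by apply/seteqP; split => [x xA j _|x xA j]; exact: xA.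
Qed.

(** The simplex lies in a box. *)
Lemma simplex_volume_lty v : aff_indep v -> (mu (simplex v) < +oo)%E.
Proof.
move=> vi; pose K j := \sum_i `|v i ord0 j|.
pose A j : set (measurableTypeR R) := [set` `[- K j, K j]].
have mA j : measurable (A j) by exact: measurable_itv.
have mbox := measurable_box mA.
apply: (@le_lt_trans _ _ (mu [set x | forall j, A j (x ord0 j)])).
  apply: le_measure; rewrite ?inE//; first exact: measurable_simplex.
  move=> x vx j; rewrite /A /= in_itv/= -ler_norml -[x](baryK x vi) summxE.
  apply: le_trans (ler_norm_sum _ _ _) _; apply: ler_sum => i _.
  rewrite mxE normrM ger0_norm ?bary_ge0//.
  by rewrite ler_piMl// bary_le1.
rewrite lebesgue_rV_box// -ge0_fin_numE; last first.
  by rewrite -lebesgue_rV_box.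
apply: (big_ind (fun x : \bar R => x \is a fin_num)) => // [x y|j _].
  exact: fin_numM.
by rewrite /A lebesgue_measure_itv/=; case: ifP.
Qed.

(** The barycentric coordinates equal [1 / (n + 1)] at the centroid and are
    Lipschitz, so a small cube around the centroid lies in the simplex. *)
Lemma simplex_volume_gt0 v : aff_indep v -> (0 < mu (simplex v))%E.
Proof.
move=> vi.
have /choice[ad bE] : forall i, exists ad : R * ('I_n -> R),
    forall x, bary v i x = ad.1 + \sum_j x ord0 j * ad.2 j.
  by move=> i; have [a [d H]] := baryE v i; exists (a, d).
(* A common Lipschitz constant of all barycentric coordinates, for the sup
   norm. *)
pose D := \sum_i \sum_j `|(ad i).2 j|.
have D0 : 0 <= D by apply: sumr_ge0 => i _; exact: sumr_ge0.
pose e := (n.+1%:R * (D + 1))^-1 : R.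
have e0 : 0 < e by rewrite invr_gt0 mulr_gt0// ltr_wpDl.
pose c := centroid v.
pose A j : set (measurableTypeR R) := [set` `[c ord0 j - e, c ord0 j + e]].
have mA j : measurable (A j) by exact: measurable_itv.
have mbox := measurable_box mA.
apply: (@lt_le_trans _ _ (mu [set x | forall j, A j (x ord0 j)])).
  rewrite lebesgue_rV_box//.
  apply: (big_ind (fun x : \bar R => (0 < x)%E)) => // [x y|j _].
    exact: mule_gt0.
  rewrite /A lebesgue_measure_itv/= lte_fin ifT; last lra.
  by rewrite -EFinD lte_fin; lra.
apply: le_measure; rewrite ?inE//; first exact: measurable_simplex.
move=> x xA; rewrite simplexE// => i.
rewrite -(subrK (bary v i c) (bary v i x)) [X in _ + X]bary_centroid// !bE.
rewrite opprD addrACA subrr add0r -sumrB.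
rewrite addrC -[X in _ + X]opprK subr_ge0 -sumrN.
apply: le_trans (_ : \sum_j e * `|(ad i).2 j| <= _).
  apply: ler_sum => j _; apply: le_trans (ler_norm _) _.
  rewrite normrN -mulrBl normrM ler_wpM2r// ler_norml.
  by have := xA j; rewrite /A/= in_itv/= => /andP[? ?]; apply/andP; split; lra.
rewrite -mulr_sumr /e invfM -mulrA ger_pMr ?invr_gt0//.
rewrite mulrC ler_pdivrMr ?mul1r; last by rewrite ltr_wpDl.
rewrite (@le_trans _ _ D)//; last lra.
by rewrite /D (bigD1 i)//= lerDl; apply: sumr_ge0 => k _; exact: sumr_ge0.
Qed.

Lemma fine_volume_gt0 v : aff_indep v -> 0 < fine (mu (simplex v)).
Proof.
by move=> vi; rewrite fine_gt0// simplex_volume_gt0// simplex_volume_lty.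
Qed.

End simplex_volume.

Section affmap.
Context {R : realType} {n : nat}.
Implicit Types (v w : 'I_n.+1 -> 'rV[R]_n) (x y : 'rV[R]_n).
Local Notation mu := (@lebesgue_rV R n).

Definition affmap v w x : 'rV[R]_n := \sum_i bary v i x *: w i.

Lemma bary_affmap v w i x : aff_indep v -> aff_indep w ->
  bary w i (affmap v w x) = bary v i x.
Proof. by move=> vi wi; rewrite bary_comb// sum_bary. Qed.

Lemma preimage_affmap v w : aff_indep v -> aff_indep w ->
  affmap v w @^-1` simplex w = simplex v.
Proof.
move=> vi wi; rewrite !simplexE//; apply/seteqP.
by split => x /= x0 i; have := x0 i; rewrite bary_affmap.
Qed.

Lemma measurable_affmap v w : measurable_fun setT (affmap v w).
Proof.
apply: measurable_fun_coordP => j; under eq_fun do rewrite summxE.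
apply: measurable_sum => i; under eq_fun do rewrite mxE.
by apply: measurable_funM => //; exact: measurable_bary.
Qed.

Lemma affmap_shift v w t : aff_indep v -> aff_indep w ->
  exists s, forall y, affmap v w y + t = affmap v w (y + s).
Proof.
move=> vi wi; exists (affmap w v (affmap v w 0 + t)) => y.
rewrite -[LHS](baryK _ wi); apply: eq_bigr => i _; congr (_ *: _).
by rewrite !baryD !bary_affmap// baryD bary_affmap//; ring.
Qed.

(** Proportionality of [E |-> mu (affmap v w @^-1` E)] and [mu], with the
    constant read off from [E = simplex w], whose preimage is [simplex v]:
    determinants never enter. *)
Lemma volume_preimage_affmap v w E : aff_indep v -> aff_indep w -> measurable E ->
  (mu (affmap v w @^-1` E) =
   (fine (mu (simplex v)) / fine (mu (simplex w)))%:E * mu E)%E.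
Proof.
move=> vi wi mE.
have mw := measurable_simplex wi.
have H C (mC : measurable C) := lebesgue_rV_preimage_mul (measurable_affmap v w)
  (fun t => affmap_shift t vi wi) mC mw.
have := H _ mw; have {H} := H _ mE; rewrite !preimage_affmap//.
have volE u : aff_indep u -> exists2 a, 0 < a & mu (simplex u) = a%:E.
  move=> ui; exists (fine (mu (simplex u))); first exact: fine_volume_gt0.
  by rewrite fineK// ge0_fin_numE// simplex_volume_lty.
have [[a a0 ->] [b b0 ->]] := (volE v vi, volE w wi) => + Hb.
(* For [E = simplex w] itself, the proportionality says that [- simplex w] has
   the volume of [simplex w]. *)
have -> : mu (-%R @^-1` simplex w) = b%:E.
  apply/esym; move/(congr1 (fun z => z * a^-1%:E)%E): Hb.
  by rewrite -!muleA -!EFinM mulfV ?gt_eqF// mulr1 mule1.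
move=> /(congr1 (fun z => b^-1%:E * z)%E).
rewrite !muleA -EFinM mulVf ?gt_eqF// mul1e => <-.
by rewrite /= muleAC -EFinM mulrC.
Qed.

Lemma integral_affmap v w (f : 'rV[R]_n -> \bar R) : aff_indep v -> aff_indep w ->
  mu.-integrable (simplex w) f ->
  (\int[mu]_(x in simplex v) f (affmap v w x) =
   (fine (mu (simplex v)) / fine (mu (simplex w)))%:E *
   \int[mu]_(x in simplex w) f x)%E.
Proof.
move=> vi wi intf; have mw := measurable_simplex wi.
have mf : measurable_fun (simplex w) f by case/integrableP : intf.
have k0 : 0 <= fine (mu (simplex v)) / fine (mu (simplex w)).
  by rewrite divr_ge0// fine_ge0.
have H (g : 'rV[R]_n -> \bar R) : measurable_fun (simplex w) g ->
    (forall x, 0 <= g x)%E ->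
    (\int[mu]_(x in simplex v) g (affmap v w x) =
   (fine (mu (simplex v)) / fine (mu (simplex w)))%:E *
   \int[mu]_(x in simplex w) g x)%E.
  move=> mg g0; rewrite -(preimage_affmap vi wi).
  rewrite -(ge0_integral_pushforward (measurable_affmap v w) mu mw mg)//.
  rewrite (eq_measure_integral (mscale (NngNum k0) mu)).
    by rewrite ge0_integral_mscale// preimage_affmap.
    exact: measurable_affmap.
  by move=> ? A mA _; exact: volume_preimage_affmap.
rewrite integralE [in RHS]integralE muleBr//; last exact: integrable_add_def.
rewrite -!H//; last 2 first.
- exact: measurable_funeneg.
- exact: measurable_funepos.
by congr (_ - _)%E; apply: eq_integral => x _; rewrite unlock.
Qed.

End affmap.

(** * Symmetrization, measurability and integrability of convex functions *)

Section rotation.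
Context {R : realType} {n : nat}.
Implicit Types (v w : 'I_n.+1 -> 'rV[R]_n) (x y : 'rV[R]_n).

(** The affine automorphism of the simplex that permutes its vertices
    cyclically. It preserves mean values, and the [n + 1] images of a point
    have the centroid as their average. *)
Definition vertex_rot v (k : 'I_n.+1) x : 'rV[R]_n := affmap v (fun i => v (i + k)) x.

Lemma rot0 v x : aff_indep v -> vertex_rot v 0 x = x.
Proof.
move=> vi; rewrite -[RHS](baryK x vi); apply: eq_bigr => i _.
by rewrite addr0.
Qed.

Lemma simplex_rot v k x : aff_indep v -> simplex v x -> simplex v (vertex_rot v k x).
Proof.
move=> vi vx; apply: (@sub_simplex _ _ v (fun i => v (i + k))).
  by move=> i; exact: simplex_vertex.
apply: simplex_comb => [i|]; first exact: bary_ge0.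
exact: sum_bary.
Qed.

Lemma sum_shift (V : nmodType) (F : 'I_n.+1 -> V) (i : 'I_n.+1) :
  \sum_k F (i + k) = \sum_k F k.
Proof. by rewrite [RHS](reindex_inj (addrI i)). Qed.

Lemma mean_rot v x : aff_indep v -> \sum_k n.+1%:R^-1 *: vertex_rot v k x = centroid v.
Proof.
move=> vi; rewrite -scaler_sumr; congr (_ *: _).
rewrite /vertex_rot /affmap exchange_big /=.
under eq_bigr do rewrite -scaler_sumr sum_shift.
by rewrite -scaler_suml sum_bary// scale1r.
Qed.

Lemma convex_centroid_le v f x : aff_indep v -> convex_function (simplex v) f ->
  simplex v x -> f (centroid v) <= n.+1%:R^-1 * \sum_k f (vertex_rot v k x).
Proof.
move=> vi cf vx; rewrite -(mean_rot x vi) mulr_sumr.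
apply: (@convex_function_sum _ _ (simplex v) f _ (fun=> n.+1%:R^-1)) => //.
- exact: convex_simplex.
- exact: sum_inv_card.
- by move=> k; exact: simplex_rot.
Qed.

Lemma convex_rot_le v f x : aff_indep v -> convex_function (simplex v) f ->
  simplex v x -> \sum_k f (vertex_rot v k x) <= \sum_i f (v i).
Proof.
move=> vi cf vx.
apply: (@le_trans _ _ (\sum_k \sum_i bary v i x * f (v (i + k)))).
  apply: ler_sum => k _.
  apply: (@convex_function_sum _ _ (simplex v) f _ (bary v ^~ x)) => //.
  - exact: convex_simplex.
  - by move=> i; exact: bary_ge0.
  - exact: sum_bary.
  - by move=> i; exact: simplex_vertex.
rewrite exchange_big /= le_eqVlt; apply/orP; left; apply/eqP.
under eq_bigr do rewrite -mulr_sumr (sum_shift (f \o v)).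
by rewrite -mulr_suml sum_bary// mul1r.
Qed.

Lemma convex_le_sum v f x : aff_indep v -> convex_function (simplex v) f ->
  simplex v x -> f x <= \sum_i `|f (v i)|.
Proof.
move=> vi cf vx; apply: le_trans (convex_function_bary vi cf vx) _.
apply: ler_sum => i _; apply: le_trans (ler_norm _) _.
by rewrite normrM ger0_norm ?bary_ge0// ler_piMl// bary_le1.
Qed.

(** The upper bound comes from the vertices; as [x] is one of the [n + 1]
    points of its rotation orbit, whose average is the centroid, it gives a
    lower bound of [f x] in terms of the value at the centroid. *)
Lemma convex_function_bounded v f : aff_indep v -> convex_function (simplex v) f ->
  exists M, forall x, simplex v x -> `|f x| <= M.
Proof.
move=> vi cf; pose K := \sum_i `|f (v i)|.
exists (n.+1%:R * `|f (centroid v)| + n.+1%:R * K) => x vx.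
have K0 : 0 <= K by exact: sumr_ge0.
have n1 : 1 <= n.+1%:R :> R by rewrite ler1n.
have KnK : K <= n.+1%:R * K by rewrite ler_peMl.
have cn := normr_ge0 (f (centroid v)).
have cc : 0 <= n.+1%:R * `|f (centroid v)| by rewrite mulr_ge0.
rewrite ler_norml; apply/andP; split; last first.
  by have := convex_le_sum vi cf vx; rewrite -/K; lra.
have := convex_centroid_le vi cf vx.
rewrite mulrC ler_pdivlMr ?ltr0n// (bigD1 0)//= rot0// => H.
have : \sum_(k < n.+1 | k != 0) f (vertex_rot v k x) <= n.+1%:R * K.
  apply: (@le_trans _ _ (\sum_(k < n.+1) K)).
    rewrite [leRHS](bigID (fun k => k != 0))/= ler_wpDr//.
      exact: sumr_ge0.
    by apply: ler_sum => k _; apply: convex_le_sum => //; exact: simplex_rot.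
  by rewrite sumr_const card_ord mulr_natl.
have : - `|f (centroid v)| * n.+1%:R <= f (centroid v) * n.+1%:R.
  by apply: ler_wpM2r => //; rewrite lerNl -normrN ler_norm.
lra.
Qed.

End rotation.

Section measurability.
Context {R : realType} {n : nat}.
Implicit Types (v w : 'I_n.+1 -> 'rV[R]_n) (x y : 'rV[R]_n).
Local Notation mu := (@lebesgue_rV R n).

(** A convex function on a polytope is upper semicontinuous, up to the
    boundary. If every barycentric coordinate of [y] is at least [1 - h] times
    that of [x], then [y = h z + (1 - h) x] for a point [z] of the simplex, so
    [f y] exceeds [f x] by at most [h] times the oscillation of [f]. A
    coordinate of [x] that vanishes imposes no condition on [y]; the smallest
    nonzero one determines the neighbourhood. *)
Lemma convex_function_usc v f x a : aff_indep v -> convex_function (simplex v) f ->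
  simplex v x -> f x < a ->
  exists2 e : R, 0 < e & forall y, simplex v y ->
    (forall i, bary v i x - e < bary v i y) -> f y < a.
Proof.
move=> vi cf vx fxa.
(* An upper bound of [f], large enough for [h] below to be less than 1. *)
pose M := \sum_i `|f (v i)| + `|f x| + (a - f x) + `|f x|.
have [fx1 fx2] := (ler_norm (f x), ler_norm (- f x)); rewrite normrN in fx2.
have K0 : 0 <= \sum_i `|f (v i)| by exact: sumr_ge0.
have M0 : a - f x <= M - f x by rewrite /M; lra.
have Mx : 0 < M - f x by lra.
pose h := (a - f x) / (2 * (M - f x)).
have h0 : 0 < h by rewrite divr_gt0//; lra.
have h1 : h < 1 by rewrite ltr_pdivrMr ?mul1r; lra.
have hM : h * (M - f x) < a - f x.
  rewrite /h (_ : _ * _ = (a - f x) / 2); first lra.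
  by field; rewrite gt_eqF.
pose m := \big[Order.min/1]_(i | 0 < bary v i x) bary v i x.
have m0 : 0 < m by exact: lt_bigmin.
exists (h * m); first exact: mulr_gt0.
move=> y vy xy.
have yi i : (1 - h) * bary v i x <= bary v i y.
  have [xi0|xi0] := ltP 0 (bary v i x); last first.
    rewrite (@le_trans _ _ 0) ?bary_ge0//.
    by rewrite mulr_ge0_le0//; lra.
  apply/ltW; apply: le_lt_trans (xy i).
  have : h * m <= h * bary v i x.
    by rewrite ler_pM2l//; apply: bigmin_le_cond.
  lra.
pose z := h^-1 *: y + (1 - h^-1) *: x.
have vz : simplex v z.
  rewrite simplexE// => i; rewrite bary_conv.
  rewrite (_ : _ + _ = h^-1 * (bary v i y - (1 - h) * bary v i x)); last first.
    by field; rewrite gt_eqF.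
  by rewrite mulr_ge0 ?invr_ge0 ?subr_ge0// ltW.
have -> : y = h *: z + (1 - h) *: x.
  rewrite /z scalerDr !scalerA mulfV ?gt_eqF// scale1r -addrA -scalerDl.
  rewrite (_ : h * (1 - h^-1) + (1 - h) = 0) ?scale0r ?addr0//.
  by field; rewrite gt_eqF.
have := (convex_functionP (simplex v) f).1 cf h z x (ltW h0) (ltW h1) vz vx.
move=> /le_lt_trans; apply.
have : h * f z <= h * M.
  rewrite ler_pM2l//; apply: le_trans (convex_le_sum vi cf vz) _.
  by rewrite /M; lra.
lra.
Qed.

(** By upper semicontinuity, the sublevel sets are relatively open; they are
    unions of sets cut out by strict rational lower bounds on the barycentric
    coordinates, of which there are countably many. *)
Lemma convex_function_measurable v f : aff_indep v -> convex_function (simplex v) f ->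
  measurable_fun (simplex v) (f : 'rV[R]_n -> measurableTypeR R).
Proof.
move=> vi cf; have mv := measurable_simplex vi => _.
apply: (measurability _ (RGenInftyO.measurableE R)) => //.
move=> _ [_ [a ->] <-].
pose box (q : {ffun 'I_n.+1 -> rat}) := [set y | forall i, ratr (q i) < bary v i y].
have mbox q : measurable (box q).
  rewrite (_ : box q = \bigcap_(i in [set: 'I_n.+1])
      (bary v i @^-1` `]ratr (q i), +oo[)).
    apply: fin_bigcap_measurable => // i _.
    by rewrite -[X in measurable X]setTI; apply: measurable_bary.
  apply/seteqP; split => y /= H i => [_|]; first by rewrite /= in_itv/= andbT.
  by have := H i I; rewrite /= in_itv/= andbT.
pose good q := simplex v `&` box q `<=` [set y | f y < a].
pose F q := if `[< good q >] then box q else set0.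
rewrite (_ : _ `&` _ = simplex v `&` \bigcup_q F q).
  apply: measurableI => //; apply: countable_bigcupT_measurable => //.
  by move=> q; rewrite /F; case: ifP.
apply/seteqP; split => x [vx]; rewrite /= ?in_itv/=; last first.
  move=> [q _]; rewrite /F; case: asboolP => // gq bq; split => //.
  by apply: gq.
move=> fxa; split => //.
have [e e0 He] := convex_function_usc vi cf vx fxa.
have /choice[q Hq] : forall i, exists q : rat,
    ratr q \in `](bary v i x - e), (bary v i x)[.
  by move=> i; apply: rat_in_itvoo; lra.
exists [ffun i => q i] => //; rewrite /F ifT.
  by move=> i; rewrite ffunE; have := Hq i; rewrite in_itv/= => /andP[].
apply/asboolP => y [vy qy]; apply: He => // i.
have := qy i; rewrite ffunE; apply: lt_trans.
by have := Hq i; rewrite in_itv/= => /andP[].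
Qed.

Lemma convex_function_integrable v f : aff_indep v ->
  convex_function (simplex v) f -> mu.-integrable (simplex v) (EFin \o f).
Proof.
move=> vi cf; apply: measurable_bounded_integrable.
- exact: measurable_simplex.
- exact: simplex_volume_lty.
- exact: convex_function_measurable.
- have [M fM] := convex_function_bounded vi cf.
  exists M; split; first exact: num_real.
  by move=> K MK x vx; apply: le_trans (fM _ vx) (ltW MK).
Qed.

End measurability.

(** * The Hermite-Hadamard inequalities on a simplex *)

Section hermite_hadamard.
Context {R : realType} {n : nat}.
Implicit Types (v w : 'I_n.+1 -> 'rV[R]_n) (x y : 'rV[R]_n).
Local Notation mu := (@lebesgue_rV R n).

Lemma aff_indep_inj v s : injective s -> aff_indep v -> aff_indep (v \o s).
Proof.
move=> sI vi u u0 uv i; rewrite -(invF_f sI i).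
apply: (vi (u \o invF sI)); rewrite (reindex_inj sI)/=.
  by under eq_bigr do rewrite invF_f.
by rewrite -[RHS]uv; apply: eq_bigr => j _; rewrite /= invF_f.
Qed.

Lemma simplex_inj v s : injective s -> simplex (v \o s) = simplex v.
Proof.
move=> sI; apply/seteqP; split; apply: sub_simplex => i.
  exact: simplex_vertex.
by rewrite -(f_invF sI i); exact: (@simplex_vertex _ _ (v \o s)).
Qed.

Lemma volume_rot v k E : aff_indep v -> measurable E ->
  mu (vertex_rot v k @^-1` E) = mu E.
Proof.
move=> vi mE; have sI := addIr k.
have := @volume_preimage_affmap _ _ v (v \o (+%R^~ k)) E vi.
rewrite simplex_inj// divff ?gt_eqF ?fine_volume_gt0// mul1e; apply => //.
exact: aff_indep_inj.
Qed.

Lemma convex_function_affmap v w f : aff_indep v -> aff_indep w ->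
  convex_function (simplex w) f ->
  convex_function (simplex v) (f \o affmap v w).
Proof.
move=> vi wi cf; apply/convex_functionP => t x y t0 t1 vx vy /=.
rewrite (_ : affmap v w _ = t *: affmap v w x + (1 - t) *: affmap v w y).
  by apply: (convex_functionP (simplex w) f).1 => //;
    rewrite -[simplex w _]/((affmap v w @^-1` simplex w) _) preimage_affmap.
rewrite /affmap !scaler_sumr -big_split; apply: eq_bigr => i _ /=.
by rewrite !scalerA -scalerDl bary_conv.
Qed.

Lemma mean_affmap v w f : aff_indep v -> aff_indep w ->
  mu.-integrable (simplex w) (EFin \o f) ->
  simplex_mean v (f \o affmap v w) = simplex_mean w f.
Proof.
move=> vi wi intf; rewrite /simplex_mean /Rintegral.
have := integral_affmap vi wi intf => /= ->.
rewrite fineM//; last by apply: integrable_fin_num => //; exact: measurable_simplex.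
have := fine_volume_gt0 vi; have := fine_volume_gt0 wi.
set a := fine _; set b := fine _ => a0 b0 /=.
by rewrite mulrA; congr (_ * _); field; rewrite !gt_eqF.
Qed.

Lemma Rintegral_sum v (I : finType) (f : I -> 'rV[R]_n -> R) : aff_indep v ->
  (forall i, mu.-integrable (simplex v) (EFin \o f i)) ->
  \int[mu]_(x in simplex v) (\sum_i f i x) =
  \sum_i \int[mu]_(x in simplex v) f i x.
Proof.
move=> vi intf; rewrite /Rintegral sum_fine => [|i _]; last first.
  by apply: integrable_fin_num; [exact: measurable_simplex|exact: intf].
rewrite -integral_sum//; last exact: measurable_simplex.
by congr fine; apply: eq_integral => x _; rewrite sumEFin.
Qed.

Lemma mean_rot_invariant v k f : aff_indep v -> convex_function (simplex v) f ->
  simplex_mean v (f \o vertex_rot v k) = simplex_mean v f.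
Proof.
move=> vi cf; have sI := addIr k.
have wi : aff_indep (v \o (+%R^~ k)) by exact: aff_indep_inj.
rewrite (mean_affmap vi wi).
  by rewrite /simplex_mean simplex_inj.
by rewrite simplex_inj//; exact: convex_function_integrable.
Qed.

Lemma convex_function_rot v k f : aff_indep v -> convex_function (simplex v) f ->
  convex_function (simplex v) (f \o vertex_rot v k).
Proof.
move=> vi cf; have sI := addIr k.
have wi : aff_indep (v \o (+%R^~ k)) by exact: aff_indep_inj.
by apply: (convex_function_affmap vi wi); rewrite simplex_inj.
Qed.

Lemma mean_sum_rot v f : aff_indep v -> convex_function (simplex v) f ->
  simplex_mean v (fun x => \sum_k f (vertex_rot v k x)) = n.+1%:R * simplex_mean v f.
Proof.
move=> vi cf; rewrite /simplex_mean Rintegral_sum//; last first.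
  by move=> k; apply: convex_function_integrable => //; exact: convex_function_rot.
rewrite mulr_sumr -/(simplex_mean v f).
rewrite (eq_bigr (fun=> simplex_mean v f)) => [|k _].
  by rewrite sumr_const card_ord mulr_natl.
by rewrite -(mean_rot_invariant k vi cf).
Qed.

Lemma mean_cst v (c : R) : aff_indep v -> simplex_mean v (fun=> c) = c.
Proof.
move=> vi; rewrite /simplex_mean Rintegral_cst; last exact: measurable_simplex.
by rewrite mulrC mulfK// gt_eqF// fine_volume_gt0.
Qed.

Lemma mean_le v f g : aff_indep v -> mu.-integrable (simplex v) (EFin \o f) ->
  mu.-integrable (simplex v) (EFin \o g) ->
  (forall x, simplex v x -> f x <= g x) -> simplex_mean v f <= simplex_mean v g.
Proof.
move=> vi intf intg fg; rewrite /simplex_mean ler_pM2l ?invr_gt0 ?fine_volume_gt0//.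
by apply: le_Rintegral => //; exact: measurable_simplex.
Qed.

Lemma integrable_cst v (c : R) : aff_indep v ->
  mu.-integrable (simplex v) (EFin \o (fun=> c)).
Proof.
move=> vi; apply: convex_function_integrable => //.
by apply/convex_functionP => t x y _ _ _ _; rewrite -mulrDl addrC subrK mul1r.
Qed.

Lemma integrable_sum_rot v f : aff_indep v -> convex_function (simplex v) f ->
  mu.-integrable (simplex v) (EFin \o (fun x => \sum_k f (vertex_rot v k x))).
Proof.
move=> vi cf; rewrite (_ : _ \o _ = fun x => (\sum_k (f (vertex_rot v k x))%:E)%E).
  apply: integrable_sum => //; first exact: measurable_simplex.
  by move=> k _; apply: convex_function_integrable => //; exact: convex_function_rot.
by apply/funext => x; rewrite /= sumEFin.
Qed.

(** The function [x |-> avg_k f (vertex_rot v k x)] has the same mean as [f]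
    and lies above the value of [f] at the centroid everywhere. *)
Lemma centroid_le_mean v f : aff_indep v -> convex_function (simplex v) f ->
  f (centroid v) <= simplex_mean v f.
Proof.
move=> vi cf; rewrite -(@ler_pM2l _ n.+1%:R)// -mean_sum_rot//.
rewrite -[leLHS](mean_cst _ vi); apply: mean_le => //.
- exact: integrable_cst.
- exact: integrable_sum_rot.
- by move=> x vx; rewrite mulrC -ler_pdivlMr// mulrC convex_centroid_le.
Qed.

(** The same average lies below the mean of [f] over the vertices everywhere. *)
Lemma mean_le_vertices v f : aff_indep v -> convex_function (simplex v) f ->
  simplex_mean v f <= n.+1%:R^-1 * \sum_i f (v i).
Proof.
move=> vi cf; rewrite mulrC ler_pdivlMr// mulrC -mean_sum_rot//.
rewrite -[leRHS](mean_cst _ vi); apply: mean_le => //.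
- exact: integrable_sum_rot.
- exact: integrable_cst.
- by move=> x vx; exact: convex_rot_le.
Qed.

End hermite_hadamard.

(** * Subdivision of the simplex by the cones over its facets *)

Section bary_hyperplane.
Context {R : realType} {n : nat}.
Implicit Types (v w : 'I_n.+1 -> 'rV[R]_n) (x y : 'rV[R]_n).
Local Notation mu := (@lebesgue_rV R n).

Lemma bary_translate v i x y z t :
  bary v i (x + t *: (y - z)) = bary v i x + t * (bary v i y - bary v i z).
Proof.
have [a [d bE]] := baryE v i; rewrite !bE opprD addrACA subrr add0r.
rewrite -sumrB mulr_sumr -addrA -big_split; congr (_ + _).
by apply: eq_bigr => j _; rewrite !mxE /=; ring.
Qed.

Lemma measurable_bary_eq v i j : measurable [set x | bary v i x = bary v j x].
Proof.
rewrite (_ : [set x | _] = (fun x => bary v i x - bary v j x) @^-1` [set 0]).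
  rewrite -[X in measurable X]setTI.
  apply: (_ : measurable_fun setT (_ : _ -> measurableTypeR R)) => //.
  by apply: measurable_funB; exact: measurable_bary.
apply/seteqP; split => x /=; first by move=> ->; rewrite subrr.
by move/eqP; rewrite subr_eq0 => /eqP.
Qed.

(** Tonelli on [R * R^n]: the direction [v_i - v_j] is transversal to the
    hyperplane, so each line parallel to it meets the hyperplane in one point,
    while all the translates of the hyperplane have the same measure. If that
    measure were positive, the integral over the translates would be too. *)
Lemma bary_eq_null v i j : aff_indep v -> i != j ->
  mu [set x | bary v i x = bary v j x] = 0%E.
Proof.
move=> vi ij; set H := [set x | _].
pose g (p : measurableTypeR R * 'rV[R]_n) : R :=
  bary v i p.2 - bary v j p.2 + 2 * p.1.
have mg : measurable_fun setT (g : _ -> measurableTypeR R).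
  apply: measurable_funD.
    by apply: measurable_funB; apply: (measurableT_comp (measurable_bary _ _)).
  by apply: measurable_funM => //; exact: measurable_fst.
have mA : measurable (g @^-1` [set 0]).
  by rewrite -[X in measurable X]setTI; apply: mg => //; exact: measurable_set1.
have mH : measurable H by exact: measurable_bary_eq.
have := integral_xsection_ysection (@lebesgue_measure R) mu mA.
rewrite [RHS]integral0_eq => [|x _]; last first.
  rewrite (_ : ysection _ x = [set (bary v j x - bary v i x) / 2]).
    exact: lebesgue_measure_set1.
  apply/seteqP; split => t; rewrite /ysection/= in_setE /g /= => ?; lra.
rewrite (eq_integral (fun=> mu H)) => [|t _]; last first.
  rewrite -(lebesgue_rV_shift (t *: (v i - v j)) mH); congr (mu _).
  apply/seteqP; split => x; rewrite /xsection/= in_setE /g /H /= !bary_translate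
    !bary_vertex// !eqxx (negbTE ij) eq_sym (negbTE ij) /= => ?; lra.
rewrite integral_cst//= => /eqP; rewrite mule_eq0 => /orP[/eqP//|].
rewrite gt_eqF//; apply: (@lt_le_trans _ _
  (lebesgue_measure (`[0, 1]%classic : set (measurableTypeR R)))).
  by rewrite lebesgue_measure_itv/= lte_fin ltr01 -EFinD lte_fin subr0.
by apply: le_measure => //; rewrite inE//; exact: measurable_itv.
Qed.

End bary_hyperplane.

Section subdivision.
Context {R : realType} {n : nat}.
Implicit Types (v w : 'I_n.+1 -> 'rV[R]_n) (x y : 'rV[R]_n).
Local Notation mu := (@lebesgue_rV R n).

(** The simplex spanned by the centroid and the facet opposite to [v_i]. *)
Definition cone v i : 'I_n.+1 -> 'rV[R]_n :=
  fun k => if k == i then centroid v else v k.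

(** A relation between the vertices of the cone, rewritten in terms of [v],
    has coefficient [u_i / (n + 1)] at [v_i]. *)
Lemma aff_indep_cone v i : aff_indep v -> aff_indep (cone v i).
Proof.
move=> vi u u0 uc.
have cE k : cone v i k = v k + (k == i)%:R *: (centroid v - v i).
  rewrite /cone; case: eqP => [->|_]; first by rewrite scale1r addrC subrK.
  by rewrite scale0r addr0.
have H : \sum_k (u k - (k == i)%:R * u i + n.+1%:R^-1 * u i) *: v k = 0.
  rewrite -[RHS]uc; under [RHS]eq_bigr do rewrite cE scalerDr scalerA.
  rewrite big_split /= -scaler_suml [X in _ + X *: _](bigD1 i)//= eqxx mulr1.
  rewrite [X in u i + X]big1 ?addr0 => [|k /negbTE ->]; last by rewrite mulr0.
  rewrite scalerBr /centroid scalerA scaler_sumr.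
  under eq_bigr do rewrite scalerDl scalerBl.
  rewrite big_split sumrB /= [X in _ - X](bigD1 i)//= eqxx mul1r.
  rewrite [X in u i *: v i + X]big1 ?addr0 => [|k /negbTE ->]; last first.
    by rewrite mul0r scale0r.
  by rewrite -addrA [- _ + _]addrC; under [X in _ + (X - _)]eq_bigr do rewrite mulrC.
have H0 := vi _ _ H.
have {}H0 k : u k - (k == i)%:R * u i + n.+1%:R^-1 * u i = 0.
  apply: H0; rewrite big_split sumrB /= u0 (bigD1 i)//= eqxx mul1r.
  rewrite big1 => [|l /negbTE ->]; last by rewrite mul0r.
  by rewrite -mulr_suml sum_inv_card; ring.
have ui : u i = 0.
  have := H0 i; rewrite eqxx mul1r subrr add0r => /eqP.
  by rewrite mulf_eq0 invr_eq0 pnatr_eq0 => /eqP.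
by move=> k; have := H0 k; rewrite ui !mulr0 subr0 addr0.
Qed.

Arguments aff_indep_cone [v] i _.

Lemma bary_cone v i k x : aff_indep v ->
  bary (cone v i) k x =
  bary v k x - bary v i x + (k == i)%:R * (n.+1%:R * bary v i x).
Proof.
move=> vi; set b := bary v i x.
have N0 : n.+1%:R != 0 :> R by rewrite pnatr_eq0.
pose l k := bary v k x - b + (k == i)%:R * (n.+1%:R * b).
have l1 : \sum_k l k = 1.
  rewrite /l big_split sumrB /= sum_bary// sumr_const card_ord (bigD1 i)//= eqxx.
  rewrite big1 => [|j /negbTE ->]; last by rewrite mul0r.
  by rewrite -[b *+ _]mulr_natl mul1r addr0 subrK.
rewrite -[RHS]/(l k) -(bary_comb k (aff_indep_cone i vi) l1); congr bary.
apply/esym; rewrite -[RHS](baryK x vi).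
rewrite (bigD1 i)//= [RHS](bigD1 i)//= {1}/cone eqxx.
have -> : \sum_(j | j != i) l j *: cone v i j =
    \sum_(j | j != i) bary v j x *: v j - b *: \sum_(j | j != i) v j.
  rewrite scaler_sumr -sumrB; apply: eq_bigr => j ji.
  by rewrite /l /cone (negbTE ji) mul0r addr0 scalerBl.
rewrite /l eqxx mul1r subrr add0r /centroid scalerA mulrAC mulfV// mul1r.
by rewrite addrCA addrC -scalerBr (bigD1 i)//= addrK addrC.
Qed.

(** The cones are the regions where a given barycentric coordinate is the
    smallest one; hence they cover the simplex, and two of them overlap in a
    hyperplane only. *)
Lemma simplex_coneE v i x : aff_indep v ->
  simplex (cone v i) x <-> 0 <= bary v i x /\ forall j, bary v i x <= bary v j x.
Proof.
move=> vi; rewrite simplexE; last exact: aff_indep_cone.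
split=> [H|[b0 H] k]; last first.
  rewrite bary_cone// addr_ge0// ?subr_ge0// mulr_ge0// mulr_ge0//.
have b0 : 0 <= bary v i x.
  have := H i; rewrite bary_cone// subrr add0r eqxx mul1r.
  by rewrite pmulr_rge0.
split=> // j; have [->//|ji] := eqVneq j i.
by have := H j; rewrite bary_cone// (negbTE ji) mul0r addr0 subr_ge0.
Qed.

Lemma sub_simplex_cone v i : aff_indep v -> simplex (cone v i) `<=` simplex v.
Proof.
move=> vi x /(simplex_coneE _ _ vi)[b0 H]; rewrite simplexE// => j.
exact: le_trans b0 (H j).
Qed.

(** Off the null hyperplanes where two barycentric coordinates agree, a point
    of the simplex lies in exactly one cone. *)
Lemma integral_cone v (f : 'rV[R]_n -> R) : aff_indep v ->
  mu.-integrable (simplex v) (EFin \o f) ->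
  \int[mu]_(x in simplex v) f x = \sum_i \int[mu]_(x in simplex (cone v i)) f x.
Proof.
move=> vi intf; have mv := measurable_simplex vi.
have mc i := measurable_simplex (aff_indep_cone i vi).
have cv i := sub_simplex_cone (i := i) vi.
have intc i : mu.-integrable (simplex v) ((EFin \o f) \_ (simplex (cone v i))).
  apply/integrable_restrict => //.
  by rewrite setIidr//; exact: (integrableS mv).
rewrite /Rintegral sum_fine => [|i _]; last first.
  by apply: integrable_fin_num => //; exact: (integrableS mv).
congr fine; transitivity (\int[mu]_(x in simplex v)
    \sum_i ((EFin \o f) \_ (simplex (cone v i))) x)%E; last first.
  rewrite integral_sum//; apply: eq_bigr => i _.
  by rewrite -integral_mkcondr setIidr.
apply: ae_eq_integral => //.
- by case/integrableP : intf.
- by apply: emeasurable_sum => i; case/integrableP : (intc i).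
have H : {ae mu, forall x, forall i j, i != j -> bary v i x != bary v j x}.
  apply: filter_forall => i; apply: filter_forall => j.
  have [->|ij] := eqVneq i j; first by apply: nearW => x.
  exists [set x | bary v i x = bary v j x]; split => //.
  - exact: measurable_bary_eq.
  - exact: bary_eq_null.
  - by move=> x /= /not_implyP[_ /negP/negPn/eqP].
apply: filterS H => x xne vx.
have [i _ imin] := arg_minP (fun i => bary v i x) (isT : predT (ord0 : 'I_n.+1)).
rewrite (bigD1 i)//= big1 ?adde0 => [|j ji]; last first.
  rewrite patchE ifF//; apply/negbTE/negP => /set_mem.
  move=> /(simplex_coneE _ _ vi)[_ /(_ i) jmin].
  have := xne _ _ ji; rewrite eq_le jmin imin//.
rewrite patchE mem_set//; apply/simplex_coneE => //; split.
  exact: bary_ge0.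
by move=> j; exact: imin.
Qed.

(** The rotations permute the cones and preserve volume, and by the previous
    lemma for [f = 1] the volumes of the cones add up to that of the simplex. *)
Lemma volume_cone v i : aff_indep v ->
  fine (mu (simplex v)) = n.+1%:R * fine (mu (simplex (cone v i))).
Proof.
move=> vi.
have H j : mu (simplex (cone v j)) = mu (simplex (cone v 0)).
  rewrite -(volume_rot j vi (measurable_simplex (aff_indep_cone j vi))).
  congr (mu _); apply/seteqP.
  have rE k x : bary v k (vertex_rot v j x) = bary v (k - j) x.
    rewrite /vertex_rot /affmap (reindex_inj (addIr (- j)))/=.
    under eq_bigr do rewrite subrK.
    rewrite (bary_comb (l := fun k => bary v (k - j) x))//.
    by rewrite -[RHS](sum_bary x vi) [RHS](reindex_inj (addIr (- j))).
  split=> x /=.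
    move=> /(simplex_coneE _ _ vi)[]; rewrite rE subrr => b0 b.
    apply/simplex_coneE => //; split=> // k.
    by have := b (k + j); rewrite rE addrK.
  move=> /(simplex_coneE _ _ vi)[b0 b].
  by apply/simplex_coneE => //; rewrite rE subrr; split=> // k; rewrite rE.
have := integral_cone vi (integrable_cst 1 vi).
rewrite Rintegral_cst ?mul1r; last exact: measurable_simplex.
move=> ->; rewrite (eq_bigr (fun=> fine (mu (simplex (cone v i))))).
  by rewrite sumr_const card_ord mulr_natl.
move=> j _; rewrite Rintegral_cst ?mul1r.
  by congr fine; exact: etrans (H j) (esym (H i)).
by apply: measurable_simplex; exact: aff_indep_cone.
Qed.

Lemma mean_cone v f : aff_indep v -> mu.-integrable (simplex v) (EFin \o f) ->
  simplex_mean v f = n.+1%:R^-1 * \sum_i simplex_mean (cone v i) f.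
Proof.
move=> vi intf; rewrite /simplex_mean integral_cone// !mulr_sumr.
apply: eq_bigr => i _; rewrite (volume_cone i vi) mulrA; congr (_ * _).
by rewrite invfM.
Qed.

End subdivision.

(** * The extremal function *)

Section sharpness.
Context {R : realType} {n : nat}.
Implicit Types (v w : 'I_n.+1 -> 'rV[R]_n) (x y : 'rV[R]_n).

(** The extremal function: it is affine on each cone over a facet and vanishes
    at the vertices. *)
Definition neg_min_bary v x : R :=
  \big[Order.max/ - bary v ord0 x]_i (- bary v i x).

Lemma neg_min_bary_le v x c :
  neg_min_bary v x <= c <-> forall i, - bary v i x <= c.
Proof.
split=> [H i|H]; last exact: bigmax_le.
exact: le_trans (le_bigmax _ _ i) H.
Qed.

Lemma neg_min_baryE v i x : (forall j, bary v i x <= bary v j x) ->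
  neg_min_bary v x = - bary v i x.
Proof.
move=> imin; apply/eqP; rewrite eq_le; apply/andP; split.
  by apply/neg_min_bary_le => j; rewrite lerN2.
exact: (neg_min_bary_le v x _).1 (lexx _) i.
Qed.

Lemma convex_neg_min_bary v (D : set 'rV[R]_n) :
  convex_function D (neg_min_bary v).
Proof.
apply/convex_functionP => t x y t0 t1 _ _; apply/neg_min_bary_le => i.
rewrite bary_conv opprD -!mulrN; apply: lerD; apply: ler_wpM2l => //; rewrite ?subr_ge0//.
  exact: (neg_min_bary_le _ _ _).1.
exact: (neg_min_bary_le _ _ _).1.
Qed.

Lemma neg_min_bary_cone_vertex v i k : aff_indep v ->
  neg_min_bary v (cone v i k) = - bary v i (cone v i k).
Proof.
move=> vi; apply: neg_min_baryE.
by have [] := (simplex_coneE i (cone v i k) vi).1 (@simplex_vertex _ _ (cone v i) k).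
Qed.

Lemma bary_cone_vertex v i k : aff_indep v ->
  bary v i (cone v i k) = (k == i)%:R * n.+1%:R^-1.
Proof.
move=> vi; rewrite /cone; have [_|ki] := eqVneq k i.
  by rewrite bary_centroid// mul1r.
by rewrite bary_vertex// eq_sym (negbTE ki) mul0r.
Qed.

(** On each cone the function is affine, so both Hermite-Hadamard bounds agree
    there. *)
Lemma mean_neg_min_bary v : aff_indep v ->
  simplex_mean v (neg_min_bary v) = - n.+1%:R^-1 ^+ 2.
Proof.
move=> vi; rewrite mean_cone//; last first.
  by apply: convex_function_integrable => //; exact: convex_neg_min_bary.
rewrite (eq_bigr (fun=> - n.+1%:R^-1 ^+ 2)) => [|i _].
  by rewrite mulr_sumr -mulr_suml sum_inv_card mul1r.
have wi : aff_indep (cone v i) by exact: aff_indep_cone.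
have avgE : n.+1%:R^-1 * \sum_k neg_min_bary v (cone v i k) = - n.+1%:R^-1 ^+ 2.
  rewrite (bigD1 i)//= big1 => [|k /negbTE ki]; last first.
    by rewrite neg_min_bary_cone_vertex// bary_cone_vertex// ki mul0r oppr0.
  by rewrite neg_min_bary_cone_vertex// bary_cone_vertex// eqxx mul1r addr0 mulrN.
apply/eqP; rewrite eq_le; apply/andP; split.
  by rewrite -avgE; apply: mean_le_vertices => //; exact: convex_neg_min_bary.
suff <- : neg_min_bary v (centroid (cone v i)) = - n.+1%:R^-1 ^+ 2.
  by apply: centroid_le_mean => //; exact: convex_neg_min_bary.
have cT : simplex (cone v i) (centroid (cone v i)).
  by rewrite simplexE// => k; rewrite bary_centroid// invr_ge0.
rewrite (neg_min_baryE ((simplex_coneE _ _ vi).1 cT).2) -avgE.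
rewrite /centroid scaler_sumr bary_sum ?sum_inv_card// -mulr_sumr -mulrN -sumrN.
by congr (_ * _); apply: eq_bigr => k _; rewrite neg_min_bary_cone_vertex.
Qed.

End sharpness.

(** * Comparison of the two gaps *)

Theorem theorem4 (R : realType) (n : nat) (v : 'I_n.+1 -> 'rV[R]_n)
    (n_ge1 : (1 <= n)%N) (v_simplex : simplex_vertices v) :
  (forall f : 'rV[R]_n -> R, convex_function (simplex v) f ->
     0 <= left_gap v f /\ left_gap v f <= n%:R * right_gap v f) /\
  (forall c : R, c < n%:R ->
     exists f : 'rV[R]_n -> R,
       convex_function (simplex v) f /\ ~ (left_gap v f <= c * right_gap v f)).
Proof.
have vi := simplex_vertices_aff_indep v_simplex.
have N0 : n.+1%:R != 0 :> R by rewrite pnatr_eq0.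
have NE : n.+1%:R = n%:R + 1 :> R by rewrite natr1.
split=> [f cf|c cn].
  rewrite /left_gap /right_gap -/(centroid v).
  split; first by rewrite subr_ge0; exact: centroid_le_mean.
  set m := simplex_mean v f; set S := \sum_i f (v i).
  have coneE i : \sum_k f (cone v i k) = f (centroid v) + (S - f (v i)).
    rewrite (bigD1 i)//= /S [in RHS](bigD1 i)//= [f (v i) + _]addrC addrK.
    rewrite {1}/cone eqxx; congr (_ + _).
    by apply: eq_bigr => k ki; rewrite /cone (negbTE ki).
  (* The upper bound [mean_le_vertices] on every cone, summed over the cones. *)
  have : n.+1%:R * m <= n.+1%:R^-1 * (n.+1%:R * f (centroid v) + n%:R * S).
    rewrite /m mean_cone//; last exact: convex_function_integrable.
    rewrite mulrA mulfV// mul1r.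
    apply: (@le_trans _ _ (\sum_i n.+1%:R^-1 * \sum_k f (cone v i k))).
      apply: ler_sum => i _; apply: mean_le_vertices.
        exact: aff_indep_cone.
      apply: convex_functionS cf; exact: sub_simplex_cone.
    rewrite -mulr_sumr; apply: ler_wpM2l; first by rewrite invr_ge0.
    under eq_bigr do rewrite coneE.
    rewrite big_split sumrB /= !sumr_const !card_ord -/S.
    by rewrite -[f _ *+ _]mulr_natl -[S *+ _]mulr_natl NE; lra.
  rewrite mulrDr [_^-1 * (_ * f _)]mulrA mulVf// mul1r [_^-1 * _]mulrCA.
  by rewrite NE; lra.
exists (neg_min_bary v); split; first exact: convex_neg_min_bary.
rewrite /left_gap /right_gap -/(centroid v) mean_neg_min_bary//.
rewrite big1 => [|k _]; last first.
  (* The function vanishes at a vertex because there is another vertex: [n >= 1]. *)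
  have [j kj] : exists j : 'I_n.+1, k != j.
    exists (if k == ord0 then ord_max else ord0); case: ifP => [/eqP ->|->//].
    by rewrite -(inj_eq val_inj)/= ltn_eqF.
  rewrite (@neg_min_baryE _ _ _ j) => [|i].
    by rewrite bary_vertex// eq_sym (negbTE kj) oppr0.
  by rewrite !bary_vertex// [j == k]eq_sym (negbTE kj) ler0n.
rewrite (@neg_min_baryE _ _ _ ord0) => [|j]; last by rewrite !bary_centroid.
rewrite bary_centroid//.
set a : R := n.+1%:R^-1; have a0 : 0 < a by rewrite invr_gt0.
have aE : n%:R * a ^+ 2 = a - a ^+ 2.
  by rewrite /a; have := N0; rewrite NE => ?; field.
rewrite mulr0 sub0r !opprK => H.
have : n%:R * a ^+ 2 <= c * a ^+ 2 by rewrite aE; lra.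
by rewrite ler_pM2r ?exprn_gt0// leNgt cn.
Qed.
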